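(* Let $k$ be a positive integer and consider the $k$-th order system of two rational difference equations $$x_n=\frac{\alpha+\sum^{k}_{i=1}\beta_{i}x_{n-i} + \sum^{k}_{i=1}\gamma_{i}y_{n-i}}{A+\sum^{k}_{j=1}B_{j}x_{n-j} + \sum^{k}_{j=1}C_{j}y_{n-j}},\qquad y_n=\frac{p+\sum^{k}_{i=1}\delta_{i}x_{n-i} + \sum^{k}_{i=1}\epsilon_{i}y_{n-i}}{q+\sum^{k}_{j=1}D_{j}x_{n-j} + \sum^{k}_{j=1}E_{j}y_{n-j}},\qquad n\in\mathbb{N},$$ with non-negative real parameters and non-negative initial conditions. Assume that there exists $M_1>0$ such that every solution satisfies $y_n\le M_1x_n$ for all $n\in\mathbb{N}$. Assume further that $A=0$, $\alpha=0$, and $I_\beta\cup(I_\gamma\setminus I_C)\subseteq I_B$. Then there exist $M>0$ and $N\in\mathbb{N}$ such that every solution (from any non-negative initial conditions) satisfies $x_n\le M$ and $y_n\le M$ for all $n>N$.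
   Context: $\mathbb{N}=\{1,2,\dots\}$. Initial conditions are $x_{1-k},\dots,x_0,y_{1-k},\dots,y_0\ge 0$; a solution is a pair of sequences generated by the system from non-negative initial conditions for which all denominators are positive for every $n\in\mathbb{N}$. Index sets in $\{1,\dots,k\}$: $I_\beta=\{i:\beta_i>0\}$, $I_\gamma=\{i:\gamma_i>0\}$, $I_B=\{j:B_j>0\}$, $I_C=\{j:C_j>0\}$. *)

(* Defs.v *)
From HB Require Import structures.
From mathcomp Require Import all_boot all_order all_algebra.
From mathcomp Require Import reals.

Set Implicit Arguments.
Unset Strict Implicit.
Unset Printing Implicit Defensive.

Import Order.TTheory GRing.Theory Num.Theory.
Local Open Scope ring_scope.

(** The indices 1, ..., k are the elements of ['I_k] shifted by one: the
    coefficient of lag [i.+1] is stored at [i : 'I_k].  Sequences are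
    functions on [int], so that the initial conditions sit at their actual
    indices 1-k, ..., 0; values below 1-k are never used. *)

Record system (R : realType) (k : nat) := System {
  alpha : R; beta : 'I_k -> R; gamma : 'I_k -> R;
  coefA : R; coefB : 'I_k -> R; coefC : 'I_k -> R;
  coefp : R; delta : 'I_k -> R; epsilon : 'I_k -> R;
  coefq : R; coefD : 'I_k -> R; coefE : 'I_k -> R
}.

Section System.
Variables (R : realType) (k : nat).
Implicit Types (s : system R k) (x y : int -> R) (n : nat).

Definition nonneg_params s : Prop :=
  [/\ [/\ 0 <= alpha s, 0 <= coefA s, 0 <= coefp s & 0 <= coefq s],
      forall i, [/\ 0 <= beta s i, 0 <= gamma s i,
                    0 <= coefB s i & 0 <= coefC s i]
    & forall i, [/\ 0 <= delta s i, 0 <= epsilon s i,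
                    0 <= coefD s i & 0 <= coefE s i]].

Definition affine (a : R) (b c : 'I_k -> R) x y n : R :=
  a + \sum_(i < k) b i * x (n%:Z - i.+1%:Z)
    + \sum_(i < k) c i * y (n%:Z - i.+1%:Z).

Definition xnum s := affine (alpha s) (beta s) (gamma s).
Definition xden s := affine (coefA s) (coefB s) (coefC s).
Definition ynum s := affine (coefp s) (delta s) (epsilon s).
Definition yden s := affine (coefq s) (coefD s) (coefE s).

Definition nonneg_init x y : Prop :=
  forall m : int, 1 - k%:Z <= m <= 0 -> 0 <= x m /\ 0 <= y m.

Definition solution s x y : Prop :=
  nonneg_init x y /\
  forall n, (0 < n)%N ->
    [/\ 0 < xden s x y n, 0 < yden s x y n,
        x n%:Z = xnum s x y n / xden s x y n
      & y n%:Z = ynum s x y n / yden s x y n].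

Definition Ibeta s : {set 'I_k} := [set i | 0 < beta s i].
Definition Igamma s : {set 'I_k} := [set i | 0 < gamma s i].
Definition IB s : {set 'I_k} := [set i | 0 < coefB s i].
Definition IC s : {set 'I_k} := [set i | 0 < coefC s i].

End System.

(* Main.v *)
(** Once [n > k], every lagged term satisfies [y <= M1 * x], so the inclusion of
    index sets lets each term of the numerator of [x n] be dominated by the term
    of the denominator at the same lag. Since [alpha = A = 0], summing bounds
    [x n] by a constant, and then [y n <= M1 * x n] bounds [y n]. *)

Require Import Defs.
From mathcomp Require Import all_boot all_order all_algebra.
From mathcomp Require Import reals zify.

Set Implicit Arguments.
Unset Strict Implicit.
Unset Printing Implicit Defensive.

Import Order.TTheory GRing.Theory Num.Theory.
Local Open Scope ring_scope.

Lemma affine_ge0 (R : realType) (k : nat) (a : R) (b c : 'I_k -> R)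
    (x y : int -> R) (n : nat) :
  0 <= a -> (forall i, 0 <= b i) -> (forall i, 0 <= c i) ->
  (forall i : 'I_k, 0 <= x (n%:Z - i.+1%:Z) /\ 0 <= y (n%:Z - i.+1%:Z)) ->
  0 <= affine a b c x y n.
Proof.
move=> a0 b0 c0 xy0; rewrite /affine !addr_ge0 //; apply: sumr_ge0 => i _;
  by rewrite mulr_ge0 //; case: (xy0 i).
Qed.

Lemma solution_ge0 (R : realType) (k : nat) (s : system R k)
    (x y : int -> R) :
  nonneg_params s -> solution s x y ->
  forall m : int, 1 - k%:Z <= m -> 0 <= x m /\ 0 <= y m.
Proof.
move=> [[a0 _ p0 _] xpar ypar] [init rec].
(* Shifting the index by [k - 1] makes the initial conditions the cases [n < k]. Strong induction is
   needed because the recurrence reaches back [k] steps. *)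
suff pos (n : nat) : 0 <= x (n%:Z + 1 - k%:Z) /\ 0 <= y (n%:Z + 1 - k%:Z).
  move=> m mk; have -> : m = `|(m + k%:Z - 1)%R|%N%:Z + 1 - k%:Z by lia.
  exact: pos.
elim/ltn_ind: n => n IHn.
have [nk|kn] := ltnP n k; first by apply: init; lia.
have [l l0 ln] : exists2 l : nat, (0 < l)%N & n%:Z + 1 - k%:Z = l%:Z :> int.
  by exists (n.+1 - k)%N; lia.
have lag (i : 'I_k) : 0 <= x (l%:Z - i.+1%:Z) /\ 0 <= y (l%:Z - i.+1%:Z).
  have ik := ltn_ord i.
  have -> : l%:Z - i.+1%:Z = (n - i.+1)%N%:Z + 1 - k%:Z by lia.
  by apply: IHn; lia.
rewrite ln; case: (rec l l0) => xd0 yd0 -> ->.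
split; apply: divr_ge0; rewrite ?(ltW xd0) ?(ltW yd0) //; apply: affine_ge0 => //.
- by move=> i; case: (xpar i).
- by move=> i; case: (xpar i).
- by move=> i; case: (ypar i).
- by move=> i; case: (ypar i).
Qed.

(** Division by zero yields [0], so the ratios with vanishing denominator do
    not contribute to the constant. *)
Lemma term_le (R : realType) (b c B C M u v : R) :
  0 <= b -> 0 <= c -> 0 <= B -> 0 <= C -> 0 <= M -> 0 <= u -> 0 <= v ->
  v <= M * u -> (0 < b -> 0 < B) -> (0 < c -> 0 < C \/ 0 < B) ->
  b * u + c * v <= (b / B + c / C + M * c / B) * (B * u + C * v).
Proof.
move=> b0 c0 B0 C0 M0 u0 v0 vMu bB cCB.
have bu : b * u <= b / B * (B * u + C * v).
  move: b0; rewrite le_eqVlt => /predU1P[<-|b_gt0]; first by rewrite !mul0r.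
  rewrite mulrDr mulrA divfK ?gt_eqF ?bB// lerDl.
  by rewrite !mulr_ge0 ?invr_ge0 // ltW.
have cv : c * v <= (c / C + M * c / B) * (B * u + C * v).
  have den0 : 0 <= B * u + C * v by rewrite addr_ge0 ?mulr_ge0.
  rewrite mulrDl.
  have q1 : 0 <= c / C * (B * u + C * v) by rewrite !mulr_ge0 ?invr_ge0.
  have q2 : 0 <= M * c / B * (B * u + C * v) by rewrite !mulr_ge0 ?invr_ge0.
  have [c_gt0|c_le0] := ltP 0 c; last first.
    by apply: le_trans (addr_ge0 q1 q2); rewrite mulr_le0_ge0.
  (* If [C > 0], the term [C * v] of the denominator absorbs [c * v]. If [B > 0], first trade [v]
     for [M * u], which [B * u] absorbs; this is the source of the summand [M * c / B]. *)
  case: (cCB c_gt0) => [C_gt0|B_gt0].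
    apply: (@le_trans _ _ (c / C * (B * u + C * v))); last by rewrite lerDl.
    by rewrite mulrDr [X in _ + X]mulrA divfK ?gt_eqF// lerDr !mulr_ge0 ?invr_ge0.
  apply: (@le_trans _ _ (M * c / B * (B * u + C * v))); last by rewrite lerDr.
  rewrite mulrDr [X in X + _]mulrA divfK ?gt_eqF//.
  apply: (@le_trans _ _ (M * c * u)); first by rewrite mulrAC mulrC ler_wpM2r.
  by rewrite lerDl !mulr_ge0 ?invr_ge0.
by rewrite -addrA mulrDl lerD.
Qed.

Theorem theorem13 (R : realType) (k : nat) (k_gt0 : (0 < k)%N)
    (s : system R k) (s_ge0 : nonneg_params s)
    (y_le_x : exists M1 : R, 0 < M1 /\
       forall x y : int -> R, solution s x y ->
       forall n : nat, (0 < n)%N -> y n%:Z <= M1 * x n%:Z)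
    (A0 : coefA s = 0) (alpha0 : alpha s = 0)
    (I_sub : Ibeta s :|: (Igamma s :\: IC s) \subset IB s) :
  exists (M : R) (N : nat), [/\ 0 < M, (0 < N)%N &
    forall x y : int -> R, solution s x y ->
    forall n : nat, (N < n)%N -> x n%:Z <= M /\ y n%:Z <= M].
Proof.
have [M1 [M1_gt0 yMx]] := y_le_x; have [_ xpar _] := s_ge0.
pose K i := beta s i / Defs.coefB s i + gamma s i / Defs.coefC s i
            + M1 * gamma s i / Defs.coefB s i.
have K0 i : 0 <= K i.
  by case: (xpar i) => *; rewrite !addr_ge0 ?mulr_ge0 ?invr_ge0 // ltW.
(* The sum serves as one bound for all the nonnegative ratios [K i]. *)
pose T := \sum_i K i.
have T0 : 0 <= T by rewrite sumr_ge0.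
have KT i : K i <= T by rewrite /T (bigD1 i) //= lerDl sumr_ge0.
(* The product expands to [(1 + T) + M1 * (1 + T)], whose summands bound [x n] and [y n]
   respectively. Using [1 + T] keeps the bound positive even when [T = 0]. *)
exists ((1 + M1) * (1 + T)), k; split=> //.
  by rewrite mulr_gt0 // ltr_pwDl // ltW.
move=> x y sol n kn.
have n0 : (0 < n)%N by lia.
have [xd0 _ xE _] := sol.2 n n0.
have xT : x n%:Z <= T.
  rewrite xE ler_pdivrMr // /xnum /xden /affine A0 alpha0 !add0r -!big_split /=.
  rewrite mulr_sumr; apply: ler_sum => i _.
  have ik := ltn_ord i.
  have [u0 v0] : 0 <= x (n%:Z - i.+1%:Z) /\ 0 <= y (n%:Z - i.+1%:Z).
    by apply: (solution_ge0 s_ge0 sol); lia.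
  have vu : y (n%:Z - i.+1%:Z) <= M1 * x (n%:Z - i.+1%:Z).
    (* As [n > k], the lagged index is at least 1. This matters because initial conditions need not
       satisfy [y <= M1 * x]. *)
    have -> : n%:Z - i.+1%:Z = (n - i.+1)%N%:Z by lia.
    by apply: yMx sol _ _; lia.
  have [b0 c0 B0 C0] := xpar i.
  have IBi := subsetP I_sub i; rewrite !inE in IBi.
  apply: (@le_trans _ _ (K i * (Defs.coefB s i * x (n%:Z - i.+1%:Z)
                               + Defs.coefC s i * y (n%:Z - i.+1%:Z)))).
    apply: term_le => //; first exact: ltW.
      by move=> b_gt0; apply: IBi; rewrite b_gt0.
    (* When the coefficient of [y] in the denominator vanishes, [i] lies in [Igamma s :\: IC s],
       hence in [IB s]. *)
    move=> c_gt0; case: (ltP 0 (Defs.coefC s i)) => [|C_le0]; first by left.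
    by right; apply: IBi; rewrite c_gt0 -leNgt C_le0 orbT.
  by rewrite ler_wpM2r // addr_ge0 // mulr_ge0.
have M1T : 0 <= M1 * (1 + T) by rewrite mulr_ge0 ?addr_ge0 // ltW.
have xT1 : x n%:Z <= 1 + T by rewrite (le_trans xT) // lerDr.
rewrite mulrDl mul1r; split; first by rewrite (le_trans xT1) // lerDl.
apply: le_trans (yMx _ _ sol n n0) _.
apply: (@le_trans _ _ (M1 * (1 + T))); first by rewrite ler_pM2l.
by rewrite lerDr addr_ge0.
Qed.
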